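(* For $p,q>0$ and $s=p+q$, let $$\Psi(p,q)=2s^3(s+1)+pq\bigl(s^3-7s^2-16s-12\bigr).$$ Then $$\Psi(p,q)<0\quad\Longleftrightarrow\quad 0<s<3\ \text{ and }\ pq>\frac{2s^3(s+1)}{12+16s+7s^2-s^3}.$$ Hence the set $\{(p,q)\in(0,\infty)^2:\Psi(p,q)<0\}$ is symmetric about the line $p=q$ and is contained in the triangle $\{(p,q)\in(0,\infty)^2: p+q<3\}$.
   Context: All quantities are real; no further notation is needed. *)

(* Defs.v *)
From mathcomp Require Import all_boot all_order all_algebra.
From mathcomp Require Import all_classical all_reals.

Set Implicit Arguments.
Unset Strict Implicit.
Unset Printing Implicit Defensive.

Import Order.TTheory GRing.Theory Num.Theory.
Local Open Scope classical_set_scope.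
Local Open Scope ring_scope.

Definition Psi (R : realType) (p q : R) : R :=
  let s := p + q in
  2 * s ^+ 3 * (s + 1) + p * q * (s ^+ 3 - 7 * s ^+ 2 - 16 * s - 12).

Definition Psi_neg_set (R : realType) : set (R * R) :=
  [set x | [/\ 0 < x.1, 0 < x.2 & Psi x.1 x.2 < 0]].

Definition triangle (R : realType) : set (R * R) :=
  [set x | [/\ 0 < x.1, 0 < x.2 & x.1 + x.2 < 3]].

(* The reflection of the plane in the line p = q is the exchange of the two
   coordinates, so symmetry about that line is invariance under it. *)
Definition symmetric_about_diagonal (R : realType) (A : set (R * R)) : Prop :=
  swap_pair @` A = A.

(* Main.v *)
(* With s = p + q one has
     Psi = 2 s (s + 1) (p - q)^2 + p q (s - 3) (s + 2)^2,
   so Psi < 0 forces s < 3. For 0 < s < 3 the coefficient of - p q in Psi is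
   positive, and dividing by it gives the equivalence. *)

Require Import Defs.
From mathcomp Require Import all_boot all_order all_algebra.
From mathcomp Require Import all_classical all_reals.
From mathcomp Require Import ring lra.

Set Implicit Arguments.
Unset Strict Implicit.
Unset Printing Implicit Defensive.

Import Order.TTheory GRing.Theory Num.Theory.
Local Open Scope classical_set_scope.
Local Open Scope ring_scope.

Lemma PsiC (R : realType) (p q : R) : Psi p q = Psi q p.
Proof. by rewrite /Psi; ring. Qed.

(** The cubic splits as [12 + 16 * s] plus [s ^+ 2 * (7 - s)], and both parts are positive in this
    range. *)
Lemma denominator_gt0 (R : realType) (s : R) :
  0 < s -> s < 3 -> 0 < 12 + 16 * s + 7 * s ^+ 2 - s ^+ 3.
Proof.
move=> s0 s3; have : 0 < s ^+ 2 * (7 - s) by rewrite mulr_gt0 ?exprn_gt0//; lra.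
by lra.
Qed.

Lemma Psi_lt0_sum_lt3 (R : realType) (p q : R) :
  0 < p -> 0 < q -> Psi p q < 0 -> p + q < 3.
Proof.
move=> p0 q0; apply: contraTT; rewrite -!leNgt => s3.
(* Once [3 <= p + q], both summands of this decomposition are nonnegative. *)
have -> : Psi p q = 2 * (p + q) * (p + q + 1) * (p - q) ^+ 2
                    + p * q * (p + q - 3) * (p + q + 2) ^+ 2.
  by rewrite /Psi; ring.
by apply: addr_ge0; apply: mulr_ge0; rewrite ?sqr_ge0// !mulr_ge0//; lra.
Qed.

Theorem proposition3p2 (R : realType) :
  [/\ forall p q : R, 0 < p -> 0 < q ->
        let s := p + q in
        Psi p q < 0 <->
        0 < s < 3 /\
        p * q > 2 * s ^+ 3 * (s + 1) / (12 + 16 * s + 7 * s ^+ 2 - s ^+ 3),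
      symmetric_about_diagonal (@Psi_neg_set R)
    & @Psi_neg_set R `<=` @triangle R].
Proof.
split.
- move=> p q p0 q0 s; have s0 : 0 < s by rewrite addr_gt0.
  have PsiE : Psi p q = 2 * s ^+ 3 * (s + 1)
                        - p * q * (12 + 16 * s + 7 * s ^+ 2 - s ^+ 3).
    by rewrite /Psi -/s; ring.
  split=> [Psi_lt0|[/andP[_ s3]]].
    (* The bound [s < 3] comes first: it makes the denominator positive, so that clearing it keeps
       the inequality and leaves [PsiE]. *)
    have s3 := Psi_lt0_sum_lt3 p0 q0 Psi_lt0.
    by rewrite s0 s3 ltr_pdivrMr ?denominator_gt0// -subr_lt0 -PsiE.
  by rewrite ltr_pdivrMr ?denominator_gt0// -subr_lt0 -PsiE.
- apply/seteqP; split=> [_ [[p q] [p0 q0 Psi_lt0] <-]|[p q] [p0 q0 Psi_lt0]].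
    by split; rewrite //= PsiC.
  (* The swap is an involution, so the preimage of [(p, q)] is [(q, p)]. *)
  by exists (q, p) => //; split; rewrite //= PsiC.
- by move=> [p q] [p0 q0 Psi_lt0]; split=> //; exact: Psi_lt0_sum_lt3.
Qed.
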